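(* Let $T_1,T_2>0$ and $[0,\mathbb{T}]_2:=[0,T_1]\times[0,T_2]$. Let $W$ be a zero-mean, continuous and stationary Gaussian random field on $\mathbb{R}_+^2$ with covariance function $q_W((x,y),(x',y'))=\tilde q_W(|x-x'|,|y-y'|)$. Suppose that $l_1$ and $l_2$ are independent Lévy subordinators on $[0,T_1]$ and $[0,T_2]$, respectively, which are independent of $W$, with density functions $f_1$ and $f_2$, i.e. $f_1^x(\cdot)$ is the probability density function of $l_1(x)$ for $x\in(0,T_1]$ and $f_2^y(\cdot)$ is the probability density function of $l_2(y)$ for $y\in(0,T_2]$. Then the covariance function $q_L$ of the random field $L(x,y):=W(l_1(x),l_2(y))$, $(x,y)\in[0,\mathbb{T}]_2$, admits the representation $$q_L((x,y),(x',y'))=\int_{\mathbb{R}_+}\int_{\mathbb{R}_+}\tilde q_W(s,t)\,f_1^{|x-x'|}(s)\,f_2^{|y-y'|}(t)\,ds\,dt$$ for all $(x,y),(x',y')\in[0,\mathbb{T}]_2$ with $x\ne x'$ and $y\ne y'$.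
   Context: $(\Omega,\mathcal{F},\mathbb{P})$ is a complete probability space and $\mathbb{R}_+:=[0,+\infty)$. A Gaussian random field on $\mathbb{R}_+^2$ is a family of real random variables all of whose finite-dimensional marginals are multivariate Gaussian; ''continuous'' means that its paths are $\mathbb{P}$-almost surely continuous; ''stationary'' means that the mean is constant and the covariance function depends only on the difference of its two arguments. $W$ is jointly measurable, i.e. $\mathcal{F}\otimes\mathcal{B}(\mathbb{R}_+^2)$-$\mathcal{B}(\mathbb{R})$-measurable. A Lévy process is a real-valued process $l$ with $l(0)=0$ a.s., independent and stationary increments, and stochastic continuity; a Lévy subordinator is a Lévy process that is $\mathbb{P}$-almost surely non-decreasing (so it takes values in $\mathbb{R}_+$). The covariance function of the (zero-mean) field $L$ is $q_L((x,y),(x',y')):=\mathbb{E}(L(x,y)L(x',y'))$. *)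

(* Defs.v *)
From HB Require Import structures.
From mathcomp Require Import all_boot all_order all_algebra.
From mathcomp Require Import all_classical all_reals all_analysis.

Set Implicit Arguments.
Unset Strict Implicit.
Unset Printing Implicit Defensive.

Import Order.TTheory GRing.Theory Num.Theory.
Import numFieldNormedType.Exports.

Local Open Scope classical_set_scope.
Local Open Scope ring_scope.

Section defs.
Context (d : measure_display) (T : measurableType d) (R : realType)
  (P : probability T R).

Definition quadrant : set (R * R) := [set p | 0 <= p.1 /\ 0 <= p.2].

(* Point masses are allowed, as usual for marginals of Gaussian fields;
   [normal_prob m 0] is not the point mass at [m], hence the case split. *)
Definition gaussian_law (X : T -> R) : Prop :=
  exists m s : R, forall A : set R, measurable A ->
    P (X @^-1` A) = if 0 < s then normal_prob m s A else \d_m A.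

Definition multivariate_gaussian (n : nat) (X : 'I_n -> T -> R) : Prop :=
  forall a : 'I_n -> R, gaussian_law (fun w => \sum_(i < n) a i * X i w).

(* A random field on [D] is a function [X : I -> T -> R]; its values at indices
   outside of [D] are irrelevant. *)
Definition gaussian_field (I : Type) (D : set I) (X : I -> T -> R) : Prop :=
  (forall p, D p -> measurable_fun [set: T] (X p)) /\
  forall (n : nat) (p : 'I_n -> I), (forall i, D (p i)) ->
    multivariate_gaussian (fun i => X (p i)).

Definition zero_mean (I : Type) (D : set I) (X : I -> T -> R) : Prop :=
  forall p, D p -> ('E_P[X p] = 0)%E.

Definition continuous_field (D : set (R * R)) (X : R * R -> T -> R) : Prop :=
  {ae P, forall w, {within D, continuous (fun p => X p w)}}.

Definition stationary (D : set (R * R)) (X : R * R -> T -> R) : Prop :=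
  (forall p p', D p -> D p' -> ('E_P[X p] = 'E_P[X p'])%E) /\
  exists C : R * R -> R, forall p p', D p -> D p' ->
    covariance P (X p) (X p') = (C (p - p'))%:E.

(* Covariance function of a zero-mean field. *)
Definition cov_fun (I : Type) (X : I -> T -> R) (p p' : I) : \bar R :=
  'E_P[(fun w => X p w * X p' w)%R]%E.

Definition same_law (X Y : T -> R) : Prop :=
  forall A : set R, measurable A -> P (X @^-1` A) = P (Y @^-1` A).

Definition increment (l : R -> {RV P >-> R}) (s t : R) (w : T) : R :=
  l t w - l s w.

Definition independent_increments (a : R) (l : R -> {RV P >-> R}) : Prop :=
  forall (n : nat) (t : nat -> R),
    (forall i, (i <= n)%N -> 0 <= t i <= a) ->
    (forall i, (i < n)%N -> t i <= t i.+1) ->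
  forall B : nat -> set R, (forall i, measurable (B i)) ->
    P (\bigcap_(i < n) (increment l (t i) (t i.+1) @^-1` B i)) =
    (\prod_(i < n) P (increment l (t i) (t i.+1) @^-1` B i))%E.

Definition stationary_increments (a : R) (l : R -> {RV P >-> R}) : Prop :=
  forall s t s' t', 0 <= s -> s <= t -> t <= a -> 0 <= s' -> s' <= t' ->
    t' <= a -> t - s = t' - s' ->
    same_law (increment l s t) (increment l s' t').

Definition stochastically_continuous (a : R) (l : R -> {RV P >-> R}) : Prop :=
  forall s e : R, 0 <= s <= a -> 0 < e ->
    P [set w | e < `|increment l s t w|] @[t --> within `[0, a] (nbhs s)] --> 0%E.

(* Processes on [[0, a]]; the values [l x] for [x] outside are irrelevant. *)
Record levy_process (a : R) (l : R -> {RV P >-> R}) : Prop := LevyProcess {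
  levy0 : {ae P, forall w, l 0 w = 0} ;
  levy_indep : independent_increments a l ;
  levy_stationary : stationary_increments a l ;
  levy_continuous : stochastically_continuous a l }.

Definition levy_subordinator (a : R) (l : R -> {RV P >-> R}) : Prop :=
  levy_process a l /\
  {ae P, forall w, forall x y, 0 <= x -> x <= y -> y <= a -> l x w <= l y w}.

Definition is_pdf (X : T -> R) (f : R -> R) : Prop :=
  [/\ measurable_fun [set: R] f, (forall s, 0 <= f s) &
    forall A : set R, measurable A ->
      P (X @^-1` A) = (\int[lebesgue_measure]_(s in A) (f s)%:E)%E].

Definition sigma_field (I : Type) (D : set I) (X : I -> T -> R) : set_system T :=
  <<s \bigcup_(i in D) preimage_set_system [set: T] (X i) measurable >>.

(* For sigma-algebras, the product rule for pairs is the case where one of the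
   three events is the whole space. *)
Definition independent3 (F G H : set_system T) : Prop :=
  forall A B C, F A -> G B -> H C ->
    P (A `&` B `&` C) = (P A * P B * P C)%E.

(* [W] is taken on all of [R * R]; its values outside the quadrant matter only
   on the null event where a subordinator is negative. *)
Definition subordinated (W : R * R -> T -> R) (l1 l2 : R -> {RV P >-> R})
    (p : R * R) (w : T) : R :=
  W (l1 p.1 w, l2 p.2 w) w.

End defs.

Arguments quadrant {R}.
Arguments sigma_field {d T R I} D X.

(* Main.v *)
Require Import Defs.
From HB Require Import structures.
From mathcomp Require Import all_boot all_order all_algebra.
From mathcomp Require Import all_classical all_reals all_analysis.
From mathcomp Require Import measurable_realfun lra.

Set Implicit Arguments.
Unset Strict Implicit.
Unset Printing Implicit Defensive.

Import Order.TTheory GRing.Theory Num.Theory.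
Import numFieldNormedType.Exports.

Local Open Scope classical_set_scope.
Local Open Scope ring_scope.

(* Since W is independent of (l1, l2), the covariance of L at two points is
   E[g(U, V)], where U = (l1 x, l2 y), V = (l1 x', l2 y') and
   g(u, v) = E[W u * W v] = q(|u.1 - v.1|, |u.2 - v.2|).  As the joint
   measurability of W is only with respect to the whole sigma-algebra, not the
   one generated by W, this "freezing" is proved by rounding U and V to a finite
   grid, where independence applies cell by cell; the grid is refined using path
   continuity, first for the truncations of W, which are then removed by
   dominated convergence (E[(W u)^2] = q(0, 0) for all u).
   Finally |l_i x - l_i x'| has the law of l_i |x - x'|, by stationarity of the
   increments and monotonicity, and Fubini's theorem concludes. *)

(** * Integration against a measure given by a density *)

Section density.
Context (d : measure_display) (T : measurableType d) (R : realType).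
Variables (nu : {finite_measure set T -> \bar R})
  (mu : {sigma_finite_measure set T -> \bar R}).

(** Both [f] and the Radon-Nikodym derivative of [nu] integrate to [nu E] over every measurable [E]
    in [U], so they agree [mu]-almost everywhere there, and the change of variables known for the
    derivative carries over to [f]. *)
Lemma integral_density (f : T -> R) (U : set T) (h : T -> \bar R) :
  measurable_fun setT f -> (forall s, 0 <= f s) ->
  (forall A, measurable A -> nu A = \int[mu]_(s in A) (f s)%:E)%E ->
  measurable U -> nu.-integrable U h ->
  (\int[nu]_(s in U) h s = \int[mu]_(s in U) (h s * (f s)%:E))%E.
Proof.
move=> mf f0 nuE mU ih.
have dom : nu `<< mu.
  apply/null_content_dominatesP => A mA A0; rewrite nuE//.
  by apply: null_set_integral => //; exact/measurable_EFinP/measurable_funTS.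
have mh : measurable_fun U h := measurable_int _ ih.
rewrite -(Radon_Nikodym_change_of_variables dom)//.
apply: ae_eq_integral => //.
- by apply: emeasurable_funM => //; exact: measurable_funTS.
- apply: emeasurable_funM => //.
  exact/measurable_EFinP/measurable_funTS.
- apply: ae_eqe_mul2l => /=; apply: integral_ae_eq => //.
  + apply: (integrableS measurableT) => //.
    exact: Radon_Nikodym_integrable.
  + exact/measurable_EFinP/measurable_funTS.
  + by move=> E EU mE; rewrite -nuE// -Radon_Nikodym_integral.
Qed.

End density.

(** * Rounding of the half-line to finite grids *)

Section grid.
Context (R : realType).

(* The cap makes the grid finite while still exhausting the half-line; negative
   numbers are sent to [0]. *)
Definition grid_index (n : nat) (s : R) : 'I_(n.+1 ^ 2).+1 :=
  inord (minn (Num.truncn (s * n.+1%:R)) (n.+1 ^ 2)).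

Definition grid_point (n k : nat) : R := k%:R / n.+1%:R.

Definition grid_round (n : nat) (s : R) : R := grid_point n (grid_index n s).

Lemma grid_point_ge0 n k : 0 <= grid_point n k.
Proof. exact: divr_ge0. Qed.

Lemma val_grid_index n s :
  grid_index n s = minn (Num.truncn (s * n.+1%:R)) (n.+1 ^ 2) :> nat.
Proof. by rewrite inordK// ltnS geq_minr. Qed.

Lemma le_grid_index n : {homo grid_index n : s t / s <= t >-> (s <= t)%N}.
Proof.
move=> s t st; rewrite !val_grid_index leq_min geq_minr andbT.
rewrite (leq_trans (geq_minl _ _))//; apply: le_truncn.
exact: ler_wpM2r.
Qed.

(** The index is monotone, so its level sets are intervals. *)
Lemma measurable_grid_index n k : measurable (grid_index n @^-1` [set k]).
Proof.
apply: is_interval_measurable => s t /= sk tk u /andP[su ut].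
apply/val_inj/eqP; rewrite eqn_leq /=.
by rewrite -{1}tk -[in X in _ && X]sk !le_grid_index.
Qed.

Lemma measurable_grid_round n : measurable_fun setT (grid_round n).
Proof.
have -> : grid_round n = (fun s => \sum_(k < (n.+1 ^ 2).+1)
    grid_point n k * \1_(grid_index n @^-1` [set k]) s).
  apply/funext => s; rewrite (bigD1 (grid_index n s))//= indicE mem_set// mulr1.
  rewrite big1 ?addr0// => i ig; rewrite indicE memNset ?mulr0//.
  by move=> /= e; rewrite e eqxx in ig.
apply: measurable_sum => k; apply: measurable_funM => //.
by apply: measurable_indic; exact: measurable_grid_index.
Qed.

(** Once [n.+1] exceeds [s], the product [s * n.+1] is at most [n.+1 ^ 2]: the cap no longer acts
    and rounding down costs at most [1 / n.+1]. *)
Lemma cvg_grid_round s : 0 <= s -> grid_round n s @[n --> \oo] --> s.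
Proof.
move=> s0; apply/cvgrPdist_le => e e0.
near=> n.
have n1 : s <= n.+1%:R.
  rewrite (le_trans (y := n%:R))// ?ler_nat//.
  by near: n; exact: nbhs_infty_ger.
have n2 : n.+1%:R^-1 <= e.
  by apply: ltW; near: n; exact: (near_infty_natSinv_lt (PosNum e0)).
have sn0 : 0 <= s * n.+1%:R by exact: mulr_ge0.
rewrite /grid_round /grid_point val_grid_index (minn_idPl _); last first.
  have: (Num.truncn (s * n.+1%:R))%:R <= n.+1%:R * n.+1%:R :> R.
    by rewrite (le_trans (y := s * n.+1%:R))// ?truncn_le// ler_wpM2r.
  by rewrite -natrM ler_nat mulnn.
have /andP[t1 t2] := truncn_itv sn0.
have nS : n.+1%:R != 0 :> R by [].
rewrite -[X in `|X - _|](mulfK nS s) -mulrBl ger0_norm; last first.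
  by rewrite mulr_ge0// subr_ge0.
rewrite (le_trans _ n2)// -[leRHS]mul1r ler_wpM2r// lerBlDl.
by rewrite natr1 ltW.
Unshelve. all: by end_near. Qed.

End grid.

Lemma bounded_integrable (d : measure_display) (T : measurableType d)
    (R : realType) (mu : {finite_measure set T -> \bar R})
    (f : T -> R) (C : R) :
  measurable_fun setT f -> (forall w, `|f w| <= C) ->
  mu.-integrable setT (EFin \o f).
Proof.
move=> mf fC; apply: measurable_bounded_integrable => //.
  by rewrite ltey_eq fin_num_measure.
exists C; split; first exact: num_real.
by move=> r /ltW Cr w _ /=; exact: le_trans Cr.
Qed.

(** * Independence from a selector with finitely many values *)

Section independence.
Context (d : measure_display) (T : measurableType d) (R : realType)
  (P : probability T R).
Local Open Scope ereal_scope.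

Lemma integral_indep_event (d' : measure_display) (S : measurableType d')
    (A : set T) (X : {RV P >-> S}) (g : S -> R) (C : R) :
  measurable A -> measurable_fun setT g -> (forall s, `|g s|%R <= C)%R ->
  (forall B, measurable B -> P (A `&` X @^-1` B) = P A * P (X @^-1` B)) ->
  \int[P]_(w in A) (g (X w))%:E = P A * \int[P]_w (g (X w))%:E.
Proof.
move=> mA mg gC indep.
have c0 : (0 <= fine (P A))%R by rewrite fine_ge0.
(* As a nonnegative real, [P A] can both scale a measure and serve as a constant density. *)
pose c := NngNum c0.
have cE : c%:num%:E = P A by rewrite /= fineK// fin_num_measure.
have ig (mu : {finite_measure set S -> \bar R}) :
    mu.-integrable setT (EFin \o g).
  exact: (@bounded_integrable _ _ _ _ _ C).
have igX (mu : {finite_measure set T -> \bar R}) :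
    mu.-integrable setT (EFin \o (g \o X)).
  by apply: (@bounded_integrable _ _ _ _ _ C) => //=; exact: measurableT_comp.
(* Conditioning on [A] replaces the law of [X] by [P A] times itself; both
   restriction to [A] and scaling by [P A] are densities. *)
have e1 : \int[P]_(w in A) (g (X w))%:E = \int[mrestr P mA]_w (g (X w))%:E.
  rewrite [RHS](@integral_density _ _ _ (mrestr P mA) P (\1_A))//.
  - rewrite integral_mkcond; apply: eq_integral => w _.
    by rewrite patchE indicE; case: ifPn => _; rewrite ?mule1 ?mule0.
  - by move=> B mB; rewrite integral_indic// setIC.
have e2 (mu : {finite_measure set T -> \bar R}) :
    \int[mu]_w (g (X w))%:E = \int[pushforward mu X]_s (g s)%:E.
  rewrite integral_pushforward ?preimage_setT//.
    exact/measurable_EFinP.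
  exact: (igX mu).
rewrite e1 (e2 (mrestr P mA)) e2.
rewrite (eq_measure_integral (mscale c (distribution P X))); last first.
  move=> B mB _; rewrite /= /mscale /= /pushforward /mrestr /= setIC indep//.
  by rewrite -cE.
rewrite (@integral_density _ _ _ (mscale c (distribution P X))
  (distribution P X) (cst c%:num))//.
  by rewrite -[in RHS]cE muleC -integralZr//; exact: (ig (distribution P X)).
by move=> B mB; exact: (esym (integral_cst (distribution P X) mB _)).
Qed.

Lemma integral_finite_partition (I : finType) (K : T -> I)
    (F : I -> T -> \bar R) :
  (forall i, measurable (K @^-1` [set i])) ->
  (forall i, P.-integrable setT (F i)) ->
  \int[P]_w F (K w) w = \sum_i \int[P]_(w in K @^-1` [set i]) F i w.
Proof.
move=> mK iF.
under [RHS]eq_bigr do rewrite integral_mkcond.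
rewrite -integral_sum//; last first.
  move=> i; apply/(integrable_mkcond _ (mK i)).1.
  exact: (integrableS measurableT).
apply: eq_integral => w _.
rewrite (bigD1 (K w))//= patchE mem_set// big1 ?adde0// => i iK.
by rewrite patchE memNset//= => e; rewrite e eqxx in iK.
Qed.

(** On the right the inner integral depends on [w'] only through [K w']. Both sides thus split over
    the cells of [K] into the same sum of [P (K = i)] times the mean of [g (X i)], each [X i] having
    to be independent of its own cell only. *)
Lemma integral_indep_select (d' : measure_display) (S : measurableType d')
    (I : finType) (K : T -> I) (X : I -> {RV P >-> S}) (g : S -> R) (C : R) :
  measurable_fun setT g -> (forall s, `|g s|%R <= C)%R ->
  (forall i, measurable (K @^-1` [set i])) ->
  (forall i B, measurable B ->
    P (K @^-1` [set i] `&` X i @^-1` B) =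
    P (K @^-1` [set i]) * P (X i @^-1` B)) ->
  \int[P]_w (g (X (K w) w))%:E = \int[P]_w' \int[P]_w (g (X (K w') w))%:E.
Proof.
move=> mg gC mK indep.
have ig i : P.-integrable setT (EFin \o (g \o X i)).
  by apply: (@bounded_integrable _ _ _ _ _ C) => //=; exact: measurableT_comp.
rewrite (@integral_finite_partition _ K (fun i w => (g (X i w))%:E))//.
rewrite (@integral_finite_partition _ K
  (fun i _ => \int[P]_w (g (X i w))%:E))//.
  apply: eq_bigr => i _; rewrite (@integral_indep_event _ _ _ (X i) g C)//.
    by rewrite muleC; exact: (esym (integral_cst P (mK i) _)).
  by move=> B mB; exact: indep.
move=> i; rewrite -(fineK (integrable_fin_num measurableT (ig i))).
exact: finite_measure_integrable_cst.
Qed.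

End independence.

(** * Parameter integrals and passage to the limit *)

Lemma measurable_integral_param (d1 d2 : measure_display)
    (T1 : measurableType d1) (T2 : measurableType d2) (R : realType)
    (m2 : {sigma_finite_measure set T2 -> \bar R}) (f : T1 * T2 -> \bar R) :
  measurable_fun setT f ->
  measurable_fun setT (fun x => (\int[m2]_y f (x, y))%E).
Proof.
move=> mf.
rewrite (_ : (fun _ => _) = (fubini_F m2 f^\+ \- fubini_F m2 f^\-)%E).
  apply: emeasurable_funB; apply: measurable_fun_fubini_tonelli_F => //.
    exact: measurable_funepos.
  exact: measurable_funeneg.
apply/funext => x; rewrite integralE /fubini_F /=; congr (_ - _)%E.
  by apply: eq_integral => y _; rewrite funepos_comp.
by apply: eq_integral => y _; rewrite funeneg_comp.
Qed.

Section convergence.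
Context (d : measure_display) (T : measurableType d) (R : realType)
  (P : probability T R).

(** Dominated convergence with a constant bound, integrable because [P] is finite. *)
Lemma bounded_convergence (f_ : nat -> T -> \bar R) (f : T -> \bar R) (C : R) :
  (forall n, measurable_fun setT (f_ n)) -> measurable_fun setT f ->
  (forall n w, (`|f_ n w| <= C%:E)%E) ->
  {ae P, forall w, f_ n w @[n --> \oo] --> f w} ->
  (\int[P]_w f_ n w)%E @[n --> \oo] --> (\int[P]_w f w)%E.
Proof.
move=> mf_ mf fC f_f.
have [] := @dominated_convergence _ _ _ P setT measurableT f_ f
  (cst C%:E) => //.
- by apply: filterS f_f => w h _.
- exact: finite_measure_integrable_cst.
- by apply: aeW => w n _; exact: fC.
Qed.

Lemma abse_integral_le_bound (f : T -> \bar R) (C : R) :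
  measurable_fun setT f -> (forall w, (`|f w| <= C%:E)%E) ->
  (`|\int[P]_w f w| <= C%:E)%E.
Proof.
move=> mf fC; rewrite (le_trans (le_abse_integral _ _ _))//.
have -> : C%:E = (\int[P]_w (cst C%:E w))%E.
  by have := integral_cst P measurableT C%:E; rewrite /= probability_setT mule1.
by apply: ge0_le_integral => //; exact: measurableT_comp.
Qed.

End convergence.

(** * Joint measurability and path continuity of the field *)

Section field.
Context (d : measure_display) (T : measurableType d) (R : realType)
  (P : probability T R) (W : R * R -> T -> R).

Lemma measurable_quadrant : measurable (quadrant : set (R * R)).
Proof.
rewrite (_ : quadrant = [set` `[0%R, +oo[] `*` [set` `[0%R, +oo[]).
  exact: measurableX.
by apply/seteqP; split => -[x y] /=; rewrite /quadrant/= !in_itv/= !andbT.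
Qed.

Hypothesis mW : measurable_fun ([set: T] `*` quadrant)
  (fun z : T * (R * R) => W z.2 z.1).

(** With [S] the probability space this treats the field at a random point; with [S] a product, it
    treats integrands that depend on a parameter. *)
Lemma measurable_field_comp (d' : measure_display) (S : measurableType d')
    (f : S -> T) (U : S -> R * R) :
  measurable_fun setT f -> measurable_fun setT U ->
  (forall s, quadrant (U s)) ->
  measurable_fun setT (fun s => W (U s) (f s)).
Proof.
move=> mf mU qU.
apply: (@measurable_comp _ _ _ _ _ _ ([set: T] `*` quadrant)
  (fun z : T * (R * R) => W z.2 z.1) setT (fun s => (f s, U s))) => //.
- exact: (measurableX measurableT measurable_quadrant).
- by move=> _ [s _ <-]; split => //=.
- exact: measurable_fun_pair.
Qed.

Lemma measurable_field_at p : quadrant p -> measurable_fun setT (W p).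
Proof.
move=> qp; apply: (@measurable_field_comp _ _ id (cst p)) => //.
Qed.

Hypothesis cW : continuous_field P quadrant W.

(** The exceptional null set is chosen before the sequence and its limit, so that random points can
    be substituted later. *)
Lemma cvg_field :
  {ae P, forall w, forall (p_ : nat -> R * R) p,
    (forall n, quadrant (p_ n)) -> quadrant p ->
    p_ n @[n --> \oo] --> p -> W (p_ n) w @[n --> \oo] --> W p w}.
Proof.
apply: filterS cW => w cw p_ p qp_ qp p_p.
move/subspace_continuousP : cw => /(_ p qp) Wp.
apply: (@cvg_comp _ _ _ p_ (fun x => W x w) _ (within quadrant (nbhs p))) Wp.
(* The sequence stays in the quadrant, so its convergence is also convergence within the
   quadrant. *)
move=> A /p_p /= [N _ NA]; exists N => // n Nn; exact: NA.
Qed.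

End field.

Definition grid_round2 (R : realType) (n : nat) (p : R * R) : R * R :=
  (grid_round n p.1, grid_round n p.2).

Lemma quadrant_grid_round2 (R : realType) n (p : R * R) :
  quadrant (grid_round2 n p).
Proof. by split; exact: grid_point_ge0. Qed.

Lemma cvg_grid_round2 (R : realType) (p : R * R) :
  quadrant p -> grid_round2 n p @[n --> \oo] --> p.
Proof.
case: p => p1 p2 [/= p10 p20].
by apply: (cvg_pair (cvg_grid_round p10) (cvg_grid_round p20)).
Qed.

(** * Freezing for bounded continuous functions of two field values *)

Section freezing.
Context (d : measure_display) (T : measurableType d) (R : realType)
  (P : probability T R) (W : R * R -> T -> R) (U V : T -> R * R).
Local Open Scope ereal_scope.

Hypothesis mW : measurable_fun ([set: T] `*` quadrant)
  (fun z : T * (R * R) => W z.2 z.1).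
Hypothesis cW : continuous_field P quadrant W.
Hypotheses (mU : measurable_fun setT U) (mV : measurable_fun setT V).
Hypotheses (qU : forall w, quadrant (U w)) (qV : forall w, quadrant (V w)).
(** Rectangles suffice because grid cells are rectangles, and deterministic points because rounding
    leaves only finitely many of them. *)
Hypothesis indep : forall A1 A2 A3 A4 : set R,
  measurable A1 -> measurable A2 -> measurable A3 -> measurable A4 ->
  forall p p' (B : set (R * R)), quadrant p -> quadrant p' -> measurable B ->
  let E := (U @^-1` (A1 `*` A2)) `&` (V @^-1` (A3 `*` A4)) in
  P (E `&` (fun w => (W p w, W p' w)) @^-1` B) =
  P E * P ((fun w => (W p w, W p' w)) @^-1` B).

Lemma measurable_grid_round2 n (f : T -> R * R) : measurable_fun setT f ->
  measurable_fun setT (grid_round2 n \o f).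
Proof.
move=> mf; apply: measurable_fun_pair.
  apply: (measurableT_comp (measurable_grid_round n)).
  exact: measurableT_comp.
apply: (measurableT_comp (measurable_grid_round n)).
exact: measurableT_comp.
Qed.

Variables (g : R * R -> R) (C : R).
Hypotheses (mg : measurable_fun setT g) (gC : forall x, (`|g x| <= C)%R).

Lemma measurable_diagonal (f h : T -> R * R) :
  measurable_fun setT f -> measurable_fun setT h ->
  (forall w, quadrant (f w)) -> (forall w, quadrant (h w)) ->
  measurable_fun setT (fun w => (g (W (f w) w, W (h w) w))%:E).
Proof.
move=> mf mh qf qh; apply/measurable_EFinP; apply: measurableT_comp => //.
by apply: measurable_fun_pair; exact: (measurable_field_comp mW).
Qed.

Lemma measurable_fixed p p' : quadrant p -> quadrant p' ->
  measurable_fun setT (fun w => (g (W p w, W p' w))%:E).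
Proof.
by move=> qp qp'; exact: (@measurable_diagonal (cst p) (cst p')).
Qed.

(** The parameter space is the probability space when random points are frozen, and the plane when
    the covariance function is shown to be measurable. *)
Lemma measurable_frozen (d' : measure_display) (S : measurableType d')
    (f h : S -> R * R) :
  measurable_fun setT f -> measurable_fun setT h ->
  (forall s, quadrant (f s)) -> (forall s, quadrant (h s)) ->
  measurable_fun setT
    (fun s => \int[P]_w (g (W (f s) w, W (h s) w))%:E).
Proof.
move=> mf mh qf qh.
apply: (@measurable_integral_param _ _ _ _ _ P
  (fun z : S * T => (g (W (f z.1) z.2, W (h z.1) z.2))%:E)).
apply/measurable_EFinP; apply: measurableT_comp => //.
by apply: measurable_fun_pair; apply: (measurable_field_comp mW) => //;
  exact: measurableT_comp.
Qed.

Lemma freezing_round n :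
  \int[P]_w (g (W (grid_round2 n (U w)) w, W (grid_round2 n (V w)) w))%:E =
  \int[P]_w' \int[P]_w
    (g (W (grid_round2 n (U w')) w, W (grid_round2 n (V w')) w))%:E.
Proof.
pose N := (n.+1 ^ 2).+1.
(* [K] is the cell of [(U, V)]; it determines both rounded points. *)
pose K w := ((grid_index n (U w).1, grid_index n (U w).2),
             (grid_index n (V w).1, grid_index n (V w).2)).
pose pt (i : 'I_N * 'I_N) : R * R := (grid_point R n i.1, grid_point R n i.2).
have qpt i : quadrant (pt i) by split; exact: grid_point_ge0.
pose Xf (i : ('I_N * 'I_N) * ('I_N * 'I_N)) w := (W (pt i.1) w, W (pt i.2) w).
have mX i : measurable_fun setT (Xf i).
  by apply: measurable_fun_pair; exact: (measurable_field_at mW).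
pose X i : {RV P >-> (R * R)%type} :=
  HB.pack (Xf i) (isMeasurableFun.Build _ _ _ _ _ (mX i)).
have KE i : K @^-1` [set i] =
    (U @^-1` ((grid_index n @^-1` [set i.1.1]) `*`
              (grid_index n @^-1` [set i.1.2]))) `&`
    (V @^-1` ((grid_index n @^-1` [set i.2.1]) `*`
              (grid_index n @^-1` [set i.2.2]))).
  case: i => -[i1 i2] [i3 i4]; apply/seteqP; split => w /=; rewrite /K.
    by move=> [<- <- <- <-].
  by move=> [[-> ->] [-> ->]].
have mK i : measurable (K @^-1` [set i]).
  rewrite KE; apply: measurableI; rewrite -[X in measurable X]setTI.
    by apply: mU => //; apply: measurableX; exact: measurable_grid_index.
  by apply: mV => //; apply: measurableX; exact: measurable_grid_index.
(* By computation the rounded points are [pt (K w).1] and [pt (K w).2], so the field values are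
   [X (K w) w]. *)
apply: (@integral_indep_select _ _ _ P _ _ _ K X g C mg gC mK) => i B mB.
by rewrite KE; apply: indep => //; exact: measurable_grid_index.
Qed.

Hypothesis cg : continuous g.

Lemma freezing_bounded :
  \int[P]_w (g (W (U w) w, W (V w) w))%:E =
  \int[P]_w' \int[P]_w (g (W (U w') w, W (V w') w))%:E.
Proof.
have mUn n := measurable_grid_round2 n mU.
have mVn n := measurable_grid_round2 n mV.
have qr n (f : T -> R * R) w : quadrant ((grid_round2 n \o f) w).
  exact: quadrant_grid_round2.
(* Quantifying over [u] and [v] inside the almost sure event serves both limits: the points may
   depend on [w] on the left and are frozen on the right. *)
have cvgg : {ae P, forall w u v, quadrant u -> quadrant v ->
    (g (W (grid_round2 n u) w, W (grid_round2 n v) w))%:E @[n --> \oo] -->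
    (g (W u w, W v w))%:E}.
  apply: filterS (cvg_field cW) => w cvgW u v qu qv.
  have Wr p : quadrant p -> W (grid_round2 n p) w @[n --> \oo] --> W p w.
    move=> qp; apply: cvgW => //; last exact: cvg_grid_round2.
    by move=> n; exact: quadrant_grid_round2.
  apply: cvg_EFin; first exact: nearW.
  apply: (@cvg_comp _ _ _ (fun n => (W (grid_round2 n u) w,
    W (grid_round2 n v) w)) g _ (nbhs (W u w, W v w))); last exact: cg.
  exact: (cvg_pair (Wr _ qu) (Wr _ qv)).
have lhs : \int[P]_w (g (W (grid_round2 n (U w)) w,
    W (grid_round2 n (V w)) w))%:E @[n --> \oo] -->
    \int[P]_w (g (W (U w) w, W (V w) w))%:E.
  apply: (@bounded_convergence _ _ _ _ _ _ C).
  - move=> n.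
    exact: (@measurable_diagonal (grid_round2 n \o U) (grid_round2 n \o V)).
  - exact: measurable_diagonal.
  - by move=> n w; rewrite abse_EFin lee_fin.
  - by apply: filterS cvgg => w; exact.
have rhs : \int[P]_w' \int[P]_w (g (W (grid_round2 n (U w')) w,
    W (grid_round2 n (V w')) w))%:E @[n --> \oo] -->
    \int[P]_w' \int[P]_w (g (W (U w') w, W (V w') w))%:E.
  apply: (@bounded_convergence _ _ _ _ _ _ C).
  - move=> n.
    exact: (@measurable_frozen _ _ (grid_round2 n \o U) (grid_round2 n \o V)).
  - exact: measurable_frozen.
  - move=> n w; apply: abse_integral_le_bound.
      by apply: measurable_fixed; exact: quadrant_grid_round2.
    by move=> w'; rewrite abse_EFin lee_fin.
  - apply: aeW => w'; apply: (@bounded_convergence _ _ _ _ _ _ C).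
    + by move=> n; apply: measurable_fixed; exact: quadrant_grid_round2.
    + exact: measurable_fixed.
    + by move=> n w; rewrite abse_EFin lee_fin.
    + by apply: filterS cvgg => w; exact.
move: lhs; under eq_cvg do rewrite freezing_round.
by move=> lhs; exact: (cvg_unique (@ereal_hausdorff R) lhs rhs).
Qed.

End freezing.

(** * Truncation to a bounded interval *)

Section clip.
Context (R : realType).
Implicit Types (a : R) (n : nat).

Definition clip n a : R := Num.max (- n%:R) (Num.min a n%:R).

Lemma normr_clip_le n a : `|clip n a| <= `|a|.
Proof.
have n0 : 0 <= n%:R :> R by [].
rewrite /clip; have [h1|h1] := lerP a n%:R; last first.
  by rewrite max_r ?(ger0_norm n0) ?ger0_norm; lra.
have [h2|h2] := lerP a (- n%:R); last by [].
by rewrite normrN (ger0_norm n0) ler0_norm; lra.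
Qed.

Lemma normr_clip_le_nat n a : `|clip n a| <= n%:R.
Proof.
have n0 : 0 <= n%:R :> R by [].
by rewrite /clip ler_norml le_max lexx ge_max ge_min lexx orbT andbT/=; lra.
Qed.

Lemma clip_id n a : `|a| <= n%:R -> clip n a = a.
Proof. by rewrite ler_norml /clip => /andP[h1 h2]; rewrite min_l// max_r. Qed.

(** This makes the truncated squares increase with [n], as monotone convergence requires. *)
Lemma normr_clip_homo a :
  {homo (fun n => `|clip n a|) : m n / (m <= n)%N >-> m <= n}.
Proof.
move=> m n mn; have [h|/ltW h] := lerP `|a| m%:R.
  by rewrite !clip_id// (le_trans h)// ler_nat.
have [h'|/ltW h'] := lerP `|a| n%:R.
  by rewrite [in leRHS]clip_id// normr_clip_le.
rewrite (le_trans (normr_clip_le_nat _ _))//.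
have mn' : m%:R <= n%:R :> R by rewrite ler_nat.
have n0 : 0 <= n%:R :> R by [].
rewrite /clip; have [a0|a0] := lerP 0 a.
  move: h'; rewrite ger0_norm// => ?.
  by rewrite min_r// max_r ?ger0_norm//; lra.
move: h'; rewrite ltr0_norm// => ?.
by rewrite min_l ?max_l ?normrN ?ger0_norm//; lra.
Qed.

Lemma cvg_clip a : clip n a @[n --> \oo] --> a.
Proof.
apply: cvg_near_cst; near=> n; apply: clip_id.
near: n; exact: nbhs_infty_ger.
Unshelve. all: by end_near. Qed.

Lemma continuous_clip n : continuous (clip n).
Proof.
move=> a; apply: (@continuous_max _ _ (cst (- n%:R)) (fun a => Num.min a n%:R)).
  exact: cvg_cst.
by apply: (@continuous_min _ _ id (cst n%:R)); [exact: cvg_id|exact: cvg_cst].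
Qed.

Lemma continuous_clip_coord (f : R * R -> R) n :
  continuous f -> continuous (fun x => clip n (f x)).
Proof.
by move=> cf x; apply: continuous_comp; [exact: cf|exact: continuous_clip].
Qed.

Lemma measurable_clip n : measurable_fun setT (clip n).
Proof. exact: continuous_measurable_fun (@continuous_clip n). Qed.

End clip.

(** From [(|a| - |b|)^2 >= 0], giving up a factor two. The sum of squares thereby dominates the
    product. *)
Lemma abs_mul_le_sqrD (R : realFieldType) (a b : R) :
  `|a * b| <= a ^+ 2 + b ^+ 2.
Proof.
rewrite normrM -[a ^+ 2]real_normK ?num_real// -[b ^+ 2]real_normK ?num_real//.
move: `|a| `|b| (normr_ge0 a) (normr_ge0 b) => x y x0 y0.
by have := sqr_ge0 (x - y); nra.
Qed.

Lemma clipM_bound (R : realType) n (x : R * R) :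
  `|clip n x.1 * clip n x.2| <= n%:R * n%:R.
Proof. by rewrite normrM ler_pM// normr_clip_le_nat. Qed.

Lemma clip_sqrD_bound (R : realType) n (x : R * R) :
  `|clip n x.1 ^+ 2 + clip n x.2 ^+ 2| <= n%:R * n%:R + n%:R * n%:R.
Proof.
rewrite (le_trans (ler_normD _ _))// lerD// normrX expr2 ler_pM//;
  exact: normr_clip_le_nat.
Qed.

(** Truncation only lowers absolute values, so [a ^+ 2 + b ^+ 2] dominates all the truncated
    products. *)
Lemma cvg_integral_clipM (d : measure_display) (T : measurableType d)
    (R : realType) (P : probability T R) (a b : T -> R) :
  measurable_fun setT a -> measurable_fun setT b ->
  P.-integrable setT (fun w => (a w ^+ 2 + b w ^+ 2)%:E) ->
  (\int[P]_w (clip n (a w) * clip n (b w))%:E)%E @[n --> \oo] -->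
  (\int[P]_w (a w * b w)%:E)%E.
Proof.
move=> ma mb iab.
have mc n f : measurable_fun setT f ->
    measurable_fun setT (fun w : T => clip n (f w) : R).
  exact: (measurableT_comp (@measurable_clip R n)).
have [] // := @dominated_convergence _ _ _ P setT measurableT
  (fun n w => (clip n (a w) * clip n (b w))%:E)
  (fun w => (a w * b w)%:E) _ _ _ _ iab.
- by move=> n; apply/measurable_EFinP; apply: measurable_funM; exact: mc.
- by apply/measurable_EFinP; exact: measurable_funM.
- apply: aeW => w _; apply: cvg_EFin; first exact: nearW.
  by apply: cvgM; exact: cvg_clip.
- apply: aeW => w n _; rewrite abse_EFin lee_fin.
  rewrite (le_trans _ (abs_mul_le_sqrD _ _))// !normrM.
  by rewrite ler_pM// normr_clip_le.
Qed.

(** * Freezing for the product of two field values *)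

Section freezing_product.
Context (d : measure_display) (T : measurableType d) (R : realType)
  (P : probability T R) (W : R * R -> T -> R) (U V : T -> R * R).
Local Open Scope ereal_scope.

Hypothesis mW : measurable_fun ([set: T] `*` quadrant)
  (fun z : T * (R * R) => W z.2 z.1).
Hypothesis cW : continuous_field P quadrant W.
Hypotheses (mU : measurable_fun setT U) (mV : measurable_fun setT V).
Hypotheses (qU : forall w, quadrant (U w)) (qV : forall w, quadrant (V w)).
Hypothesis indep : forall A1 A2 A3 A4 : set R,
  measurable A1 -> measurable A2 -> measurable A3 -> measurable A4 ->
  forall p p' (B : set (R * R)), quadrant p -> quadrant p' -> measurable B ->
  let E := (U @^-1` (A1 `*` A2)) `&` (V @^-1` (A3 `*` A4)) in
  P (E `&` (fun w => (W p w, W p' w)) @^-1` B) =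
  P E * P ((fun w => (W p w, W p' w)) @^-1` B).

Variable s : R.
Hypothesis Ws : forall p, quadrant p -> \int[P]_w (W p w ^+ 2)%:E <= s%:E.

Lemma integrable_sqrD p p' : quadrant p -> quadrant p' ->
  P.-integrable setT (fun w => (W p w ^+ 2 + W p' w ^+ 2)%:E).
Proof.
move=> qp qp'.
have iW q : quadrant q -> P.-integrable setT (fun w => (W q w ^+ 2)%:E).
  move=> qq; apply/integrableP; split.
    apply/measurable_EFinP/measurable_funX.
    exact: (measurable_field_at mW).
  under eq_integral do rewrite abse_EFin ger0_norm ?sqr_ge0//.
  by rewrite (le_lt_trans (Ws qq))// ltry.
by have := integrableD measurableT (iW _ qp) (iW _ qp').
Qed.

Lemma integral_sqrD_le p p' : quadrant p -> quadrant p' ->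
  \int[P]_w (W p w ^+ 2 + W p' w ^+ 2)%:E <= (s + s)%:E.
Proof.
move=> qp qp'.
have mW2 q : quadrant q -> measurable_fun setT (fun w => (W q w ^+ 2)%:E).
  move=> qq; apply/measurable_EFinP/measurable_funX.
  exact: (measurable_field_at mW).
under eq_integral do rewrite EFinD.
rewrite ge0_integralD//; last 4 first.
- by move=> w _; rewrite lee_fin sqr_ge0.
- exact: mW2.
- by move=> w _; rewrite lee_fin sqr_ge0.
- exact: mW2.
by rewrite EFinD leeD// Ws.
Qed.

(** The bound [Ws] concerns deterministic points only. Freezing carries it to random points for the
    truncated squares, which are bounded and continuous, and monotone convergence removes the
    truncation. *)
Lemma integral_diagonal_sqrD_le :
  \int[P]_w (W (U w) w ^+ 2 + W (V w) w ^+ 2)%:E <= (s + s)%:E.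
Proof.
pose g n (x : R * R) := (clip n x.1 ^+ 2 + clip n x.2 ^+ 2)%R.
have c1 n : continuous (fun x : R * R => clip n x.1).
  by apply: continuous_clip_coord => x; exact: cvg_fst.
have c2 n : continuous (fun x : R * R => clip n x.2).
  by apply: continuous_clip_coord => x; exact: cvg_snd.
have cg n : continuous (g n).
  move=> x; apply: cvgD.
    by apply: cvgM; exact: c1.
  by apply: cvgM; exact: c2.
have mg n : measurable_fun setT (g n).
  apply: measurable_funD; apply: measurable_funX;
    exact: (measurableT_comp (@measurable_clip R n)).
have gE x : limn (fun n => (g n x)%:E) = (x.1 ^+ 2 + x.2 ^+ 2)%:E.
  apply/cvg_lim => //; apply: cvg_EFin; first exact: nearW.
  by apply: cvgD; rewrite /= expr2; apply: cvgM; exact: cvg_clip.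
have g0 n x : 0 <= (g n x)%:E by rewrite lee_fin addr_ge0// sqr_ge0.
have gnd x m n : (m <= n)%N -> (g m x)%:E <= (g n x)%:E.
  move=> mn; rewrite lee_fin /g lerD// -[leLHS]real_normK ?num_real//
    -[leRHS]real_normK ?num_real// lerXn2r ?nnegrE//; exact: normr_clip_homo.
under eq_integral => w _ do rewrite -(gE (W (U w) w, W (V w) w)).
rewrite monotone_convergence//; last 2 first.
- by move=> n; exact: (measurable_diagonal mW (mg n)).
- by move=> w _; exact: gnd.
apply: lime_le.
  apply: ereal_nondecreasing_is_cvgn => m n mn; apply: ge0_le_integral => //.
  - exact: (measurable_diagonal mW (mg m)).
  - exact: (measurable_diagonal mW (mg n)).
  - by move=> w _; exact: gnd.
apply: nearW => n.
rewrite (freezing_bounded mW cW mU mV qU qV indep (mg n)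
  (@clip_sqrD_bound R n) (cg n)).
have -> : (s + s)%:E = \int[P]_w (cst (s + s)%:E w).
  have := integral_cst P measurableT (s + s)%:E.
  by rewrite /= probability_setT mule1.
apply: ge0_le_integral => //.
- by move=> w' _; apply: integral_ge0 => w _; exact: g0.
- exact: (measurable_frozen P mW (mg n) mU mV qU qV).
(* For frozen points the truncated squares lie below the true ones, whose integral [Ws] controls. *)
move=> w' _; apply: le_trans (integral_sqrD_le (qU w') (qV w')).
apply: ge0_le_integral => //.
- exact: (measurable_fixed mW (mg n) (qU w') (qV w')).
- exact: measurable_int (integrable_sqrD (qU w') (qV w')).
move=> w _; rewrite lee_fin /g lerD// -[leLHS]real_normK ?num_real//
  -[leRHS]real_normK ?num_real// lerXn2r ?nnegrE// normr_clip_le//.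
Qed.

(** The truncated products obey the bounded case. The limit on the left is dominated by the squares
    at the random points, integrable by [integral_diagonal_sqrD_le]. *)
Lemma freezing_product :
  \int[P]_w (W (U w) w * W (V w) w)%:E =
  \int[P]_w' \int[P]_w (W (U w') w * W (V w') w)%:E.
Proof.
pose g n (x : R * R) := (clip n x.1 * clip n x.2)%R.
have cg n : continuous (g n).
  move=> x; apply: cvgM.
    by apply: continuous_clip_coord => y; exact: cvg_fst.
  by apply: continuous_clip_coord => y; exact: cvg_snd.
have mg n : measurable_fun setT (g n).
  by apply: measurable_funM; exact: (measurableT_comp (@measurable_clip R n)).
have mWU : measurable_fun setT (fun w => W (U w) w).
  exact: (measurable_field_comp mW).
have mWV : measurable_fun setT (fun w => W (V w) w).
  exact: (measurable_field_comp mW).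
have lhs : \int[P]_w (g n (W (U w) w, W (V w) w))%:E @[n --> \oo] -->
    \int[P]_w (W (U w) w * W (V w) w)%:E.
  apply: cvg_integral_clipM => //; apply/integrableP; split.
    by apply/measurable_EFinP; apply: measurable_funD; exact: measurable_funX.
  under eq_integral do rewrite abse_EFin ger0_norm ?addr_ge0 ?sqr_ge0//.
  by rewrite (le_lt_trans integral_diagonal_sqrD_le)// ltry.
have rhs : \int[P]_w' \int[P]_w (g n (W (U w') w, W (V w') w))%:E
    @[n --> \oo] -->
    \int[P]_w' \int[P]_w (W (U w') w * W (V w') w)%:E.
  apply: (@bounded_convergence _ _ _ _ _ _ (s + s)%R).
  - by move=> n; exact: (measurable_frozen P mW (mg n)).
  - apply: (@measurable_frozen _ _ _ P _ mW (fun x => x.1 * x.2)%R) => //.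
    by apply: measurable_funM.
  - move=> n w'; rewrite (le_trans (le_abse_integral _ _ _))//.
      exact: (measurable_fixed mW (mg n) (qU w') (qV w')).
    apply: le_trans (integral_sqrD_le (qU w') (qV w')).
    apply: ge0_le_integral => //.
    + apply: measurableT_comp => //.
      exact: (measurable_fixed mW (mg n) (qU w') (qV w')).
    + exact: measurable_int (integrable_sqrD (qU w') (qV w')).
    + move=> w _; rewrite abse_EFin lee_fin.
      rewrite (le_trans _ (abs_mul_le_sqrD _ _))// !normrM.
      by rewrite ler_pM// normr_clip_le.
  - apply: aeW => w'; apply: cvg_integral_clipM; [| |exact: integrable_sqrD];
      exact: (measurable_field_at mW).
move: lhs; under eq_cvg do rewrite
  (freezing_bounded mW cW mU mV qU qV indep (mg _) (@clipM_bound R _) (cg _)).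
by move=> lhs; exact: (cvg_unique (@ereal_hausdorff R) lhs rhs).
Qed.

End freezing_product.

(** * Laws of the increments of a subordinator *)

Lemma ae_eq_preimage (d : measure_display) (T : measurableType d)
    (R : realType) (P : probability T R) (X Y : {RV P >-> R}) (A : set R) :
  {ae P, forall w, X w = Y w} -> measurable A ->
  P (X @^-1` A) = P (Y @^-1` A).
Proof.
move=> XY mA.
have mX : measurable (X @^-1` A) by exact: measurable_funPTI.
have mY : measurable (Y @^-1` A) by exact: measurable_funPTI.
rewrite -[X @^-1` A]setIT -[Y @^-1` A]setIT -!integral_indic//.
apply: ae_eq_integral => //.
- by apply/measurable_EFinP; exact: measurable_indic.
- by apply/measurable_EFinP; exact: measurable_indic.
by apply: filterS XY => w XYw _; rewrite !indicE;
  congr ((nat_of_bool _)%:R%:E); apply/idP/idP; rewrite !inE /= XYw.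
Qed.

Section subordinator.
Context (d : measure_display) (T : measurableType d) (R : realType)
  (P : probability T R) (a : R) (l : R -> {RV P >-> R}).
Hypothesis subl : levy_subordinator a l.

Lemma subordinator_ge0 x : 0 <= x <= a -> {ae P, forall w, 0 <= l x w}.
Proof.
case: subl => -[l0 _ _ _] lmono /andP[x0 xa].
apply: filterS2 l0 lmono => w l0w mono.
by rewrite -[leLHS]l0w; apply: mono.
Qed.

(** The inner absolute values are those of the quadrant-valued points used in the theorem. Almost
    surely all absolute values drop for [x' < x], leaving an increment that stationarity moves to
    start at [0], where [l] vanishes. *)
Lemma subordinator_increment_law x x' A : 0 <= x <= a -> 0 <= x' <= a ->
  x != x' -> measurable A ->
  P ((fun w => `| `|l x w| - `|l x' w| |) @^-1` A) = P (l `|x - x'| @^-1` A).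
Proof.
wlog xx' : x x' / x' < x.
  move=> H hx hx' xx' mA; move: (xx'); rewrite neq_lt => /orP[lt|lt].
    rewrite distrC -[in RHS]H//; last by rewrite eq_sym.
    by congr (P _); apply/seteqP; split => w /=; rewrite distrC.
  exact: H.
move=> hx hx' _ mA; case: (subl) => -[l0 _ stat _] mono.
have /andP[x0 xa] := hx; have /andP[x'0 x'a] := hx'.
have d0 : 0 < x - x' by rewrite subr_gt0.
have da : x - x' <= a by rewrite lerBlDr ler_wpDr.
rewrite (ger0_norm (ltW d0)).
have az : 0 <= a by exact: le_trans xa.
have mD u v : measurable_fun setT (increment l u v) by exact: measurable_funB.
pose D u v : {RV P >-> R} :=
  HB.pack (increment l u v) (isMeasurableFun.Build _ _ _ _ _ (mD u v)).
have mN : measurable_fun setT (fun w => `| `|l x w| - `|l x' w| |).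
  apply: measurableT_comp => //.
  by apply: measurable_funB; exact: measurableT_comp.
pose N : {RV P >-> R} :=
  HB.pack (fun w => `| `|l x w| - `|l x' w| |)
    (isMeasurableFun.Build _ _ _ _ _ mN).
rewrite (_ : P _ = P (D x' x @^-1` A)); last first.
  apply: (@ae_eq_preimage _ _ _ P N) => //.
  apply: filterS3 (subordinator_ge0 hx) (subordinator_ge0 hx') mono => w p p' m.
  rewrite /N/D /= /increment !ger0_norm// subr_ge0.
  by apply: m => //; exact: ltW.
rewrite (_ : P _ = P (D 0 (x - x') @^-1` A)); last first.
  by apply: stat => //; rewrite ?subr0 ?(ltW xx') ?(ltW d0).
apply: ae_eq_preimage => //; apply: filterS l0 => w l0w.
by rewrite /D /= /increment l0w subr0.
Qed.

End subordinator.

(** * Expectations of independent variables with densities *)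

Lemma integral_indep_pair (d : measure_display) (T : measurableType d)
    (R : realType) (P : probability T R) (X Y : {RV P >-> R})
    (Q : R * R -> \bar R) (C : R) :
  measurable_fun setT Q -> (forall z, (`|Q z| <= C%:E)%E) ->
  (forall A B, measurable A -> measurable B ->
    P (X @^-1` A `&` Y @^-1` B) = (P (X @^-1` A) * P (Y @^-1` B))%E) ->
  (\int[P]_w Q (X w, Y w) = \int[P]_w \int[P]_w' Q (X w', Y w))%E.
Proof.
move=> mQ QC indep.
have mXY : measurable_fun setT (fun w => (X w, Y w)).
  exact: measurable_fun_pair.
pose XY : {RV P >-> (R * R)%type} :=
  HB.pack (fun w => (X w, Y w)) (isMeasurableFun.Build _ _ _ _ _ mXY).
have iQ (d' : measure_display) (S : measurableType d')
    (mu : {finite_measure set S -> \bar R}) (f : S -> R * R) :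
    measurable_fun setT f -> mu.-integrable setT (Q \o f).
  move=> mf; apply: (@le_integrable _ _ _ _ _ _ _ (cst C%:E)) => //.
  - exact: measurableT_comp.
  - by move=> s _; rewrite /= (le_trans (QC _))// lee_fin ler_norm.
  - exact: finite_measure_integrable_cst.
have XYE (f : R * R -> \bar R) : (\int[distribution P XY]_z f z =
    \int[distribution P X \x distribution P Y]_z f z)%E.
  (* Independence says that the joint law agrees with the product law on rectangles, which
     determines it. *)
  apply: eq_measure_integral => B mB _; apply/esym.
  exact: product_measure_unique.
transitivity (\int[distribution P XY]_z Q z)%E.
  by rewrite integral_pushforward//; exact: (iQ _ _ P).
rewrite XYE -(@integral21_prod_meas1 _ _ _ _ _
  (distribution P X) (distribution P Y) Q); last first.
  apply/integrableP; split => //; rewrite -XYE.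
  have : (distribution P XY).-integrable setT (Q \o id) by exact: iQ.
  by move=> /integrableP[].
have E y : (\int[distribution P X]_s Q (s, y) = \int[P]_w Q (X w, y))%E.
  rewrite integral_pushforward//.
    by apply: (measurableT_comp mQ); exact: pair2_measurable.
  apply: (iQ _ _ P (fun w => (X w, y))).
  exact: measurable_fun_pair.
under eq_integral do rewrite /fubini_G E.
have mE : measurable_fun setT (fun y => \int[P]_w Q (X w, y))%E.
  apply: (@measurable_integral_param _ _ _ _ _ P (fun z => Q (X z.2, z.1))).
  apply: (measurableT_comp mQ); apply: measurable_fun_pair => //.
  exact: measurableT_comp.
rewrite integral_pushforward// preimage_setT.
apply: (@le_integrable _ _ _ _ _ _ _ (cst C%:E)) => //.
- exact: (measurableT_comp mE).
- move=> w _; rewrite /= (@le_trans _ _ C%:E)// ?lee_fin ?ler_norm//.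
  apply: abse_integral_le_bound => //.
  by apply: (measurableT_comp mQ); exact: measurable_fun_pair.
- exact: finite_measure_integrable_cst.
Qed.

(** As [X] is nonnegative everywhere, the half-line pulls back to the whole space, so its law can be
    integrated over the half-line alone. *)
Lemma integral_nonneg_density (d : measure_display) (T : measurableType d)
    (R : realType) (P : probability T R) (X : {RV P >-> R}) (f : R -> R)
    (h : R -> \bar R) (C : R) :
  (forall w, 0 <= X w) -> is_pdf P X f -> measurable_fun setT h ->
  (forall s, (`|h s| <= C%:E)%E) ->
  (\int[P]_w h (X w) =
   \int[lebesgue_measure]_(s in `[0%R, +oo[) (h s * (f s)%:E))%E.
Proof.
move=> X0 [mf f0 Pf] mh hC.
(* [lebesgue_measure] lives on [measurableTypeR R], a copy of [R] whose
   sigma-algebra is convertible to that of [R] but has another display. *)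
have mX : measurable_fun setT (X : T -> measurableTypeR R).
  by move=> _ A mA; exact: (measurable_funPT X measurableT A mA).
pose Y : {RV P >-> measurableTypeR R} :=
  HB.pack (X : T -> measurableTypeR R) (isMeasurableFun.Build _ _ _ _ _ mX).
have mh' : measurable_fun setT (h : measurableTypeR R -> \bar R) by exact: mh.
have ih : (distribution P Y).-integrable `[0%R, +oo[ h.
  apply: (integrableS measurableT) => //.
  apply: (@le_integrable _ _ _ _ _ _ _ (cst C%:E)) => //.
  - by move=> s _; rewrite /= (le_trans (hC _))// lee_fin ler_norm.
  - exact: finite_measure_integrable_cst.
rewrite -(@integral_density _ _ _ (distribution P Y) (@lebesgue_measure R)
  f _ h)//.
have YT : Y @^-1` `[0, +oo[ = setT.
  by apply/seteqP; split => // w _ /=; rewrite in_itv/= X0.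
rewrite integral_pushforward//.
  by rewrite YT.
rewrite YT; apply: (@le_integrable _ _ _ _ _ _ _ (cst C%:E)) => //.
- exact: measurableT_comp.
- by move=> w _; rewrite /= (le_trans (hC _))// lee_fin ler_norm.
- exact: finite_measure_integrable_cst.
Qed.

(** The density integrates over [D] to a probability, so [C] times the density is an integrable
    bound. *)
Lemma integrable_bounded_mul_density (d : measure_display)
    (T : measurableType d) (R : realType) (P : probability T R)
    (X : {RV P >-> R}) (f : R -> R) (D : set R) (h : R -> \bar R) (C : R) :
  is_pdf P X f -> measurable D -> measurable_fun setT h ->
  (forall s, (`|h s| <= C%:E)%E) ->
  (@lebesgue_measure R).-integrable D (fun s => h s * (f s)%:E)%E.
Proof.
move=> [mf f0 Pf] mD mh hC.
have mf' : measurable_fun D (f : measurableTypeR R -> R).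
  exact: measurable_funTS.
have mh' : measurable_fun D (h : measurableTypeR R -> \bar R).
  exact: measurable_funTS.
apply: (@le_integrable _ _ _ (@lebesgue_measure R) D mD _
  (fun s => C%:E * (f s)%:E)%E) => //.
- by apply: emeasurable_funM => //; exact/measurable_EFinP.
- move=> s _; rewrite !abseM lee_wpmul2r// (le_trans (hC _))//.
  by rewrite lee_fin ler_norm.
- apply: integrableZl => //; apply/integrableP; split.
    exact/measurable_EFinP.
  under eq_integral do rewrite gee0_abs ?lee_fin//.
  rewrite -Pf// ltey_eq fin_num_measure// -[_ @^-1` _]setTI.
  exact: measurable_funP.
Qed.

(** * Events in the sigma-algebras generated by the processes *)

Section sigma_field.
Context (d : measure_display) (T : measurableType d) (R : realType).

Lemma sigma_field_preimage (I : Type) (D : set I) (X : I -> T -> R) i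
    (A : set R) : D i -> measurable A -> sigma_field D X (X i @^-1` A).
Proof.
move=> Di mA; apply: sub_sigma_algebra; exists i => //.
by exists A => //; rewrite setTI.
Qed.

Lemma sigma_fieldT (I : Type) (D : set I) (X : I -> T -> R) :
  sigma_field D X setT.
Proof.
exact: (@measurableT _ (g_sigma_algebraType
  (\bigcup_(i in D) preimage_set_system [set: T] (X i) measurable))).
Qed.

Lemma sigma_fieldI (I : Type) (D : set I) (X : I -> T -> R) A B :
  sigma_field D X A -> sigma_field D X B -> sigma_field D X (A `&` B).
Proof.
exact: (@measurableI _ (g_sigma_algebraType
  (\bigcup_(i in D) preimage_set_system [set: T] (X i) measurable))).
Qed.

Lemma sigma_field_preimage2 (I : Type) (D : set I) (X : I -> T -> R) i j
    (A : set (R * R)) : D i -> D j -> measurable A ->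
  sigma_field D X ((fun w => (X i w, X j w)) @^-1` A).
Proof.
move=> Di Dj mA.
(* With [T] carrying the generated sigma-algebra, the claim becomes measurability of a pair. *)
pose S : measurableType _ := g_sigma_algebraType
  (\bigcup_(i in D) preimage_set_system [set: T] (X i) measurable).
have mX k : D k -> measurable_fun setT (X k : S -> R).
  by move=> Dk _ B mB; rewrite setTI; exact: sigma_field_preimage.
have := measurable_fun_pair (mX i Di) (mX j Dj).
by move=> /(_ measurableT A mA); rewrite setTI.
Qed.

End sigma_field.

Lemma sigma_field_increment (d : measure_display) (T : measurableType d)
    (R : realType) (P : probability T R) (a : R) (l : R -> {RV P >-> R}) u v
    (A : set R) : 0 <= u <= a -> 0 <= v <= a -> measurable A ->
  sigma_field `[0, a] l ((fun w => `| `|l u w| - `|l v w| |) @^-1` A).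
Proof.
move=> hu hv mA.
have m : measurable_fun setT (fun z : R * R => `| `|z.1| - `|z.2| |).
  apply: measurableT_comp => //.
  by apply: measurable_funB; exact: measurableT_comp.
apply: (@sigma_field_preimage2 _ _ _ _ _ l u v
  ((fun z : R * R => `| `|z.1| - `|z.2| |) @^-1` A)).
- by rewrite /= in_itv.
- by rewrite /= in_itv.
- by rewrite -[X in measurable X]setTI; exact: m.
Qed.

(** * The covariance of the subordinated field *)

Theorem lemma5p2 (d : measure_display) (T : measurableType d) (R : realType)
    (P : probability T R) (T1 T2 : R)
    (W : R * R -> T -> R) (q : R -> R -> R)
    (l1 l2 : R -> {RV P >-> R}) (f1 f2 : R -> R -> R) :
  measure_is_complete P ->
  0 < T1 -> 0 < T2 ->
  measurable_fun ([set: T] `*` quadrant)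
    (fun z : T * (R * R) => W z.2 z.1) ->
  gaussian_field P quadrant W ->
  zero_mean P quadrant W ->
  continuous_field P quadrant W ->
  stationary P quadrant W ->
  (forall x y x' y' : R, 0 <= x -> 0 <= y -> 0 <= x' -> 0 <= y' ->
    cov_fun P W (x, y) (x', y') = (q `|x - x'| `|y - y'|)%:E) ->
  levy_subordinator T1 l1 ->
  levy_subordinator T2 l2 ->
  independent3 P (sigma_field `[0, T1] l1) (sigma_field `[0, T2] l2)
    (sigma_field quadrant W) ->
  (forall x, 0 < x <= T1 -> is_pdf P (l1 x) (f1 x)) ->
  (forall y, 0 < y <= T2 -> is_pdf P (l2 y) (f2 y)) ->
  forall x y x' y' : R,
    0 <= x <= T1 -> 0 <= y <= T2 -> 0 <= x' <= T1 -> 0 <= y' <= T2 ->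
    x != x' -> y != y' ->
    cov_fun P (subordinated W l1 l2) (x, y) (x', y') =
    (\int[lebesgue_measure]_(t in `[0%R, +oo[)
       \int[lebesgue_measure]_(s in `[0%R, +oo[)
         (q s t * f1 `|x - x'| s * f2 `|y - y'| t)%:E)%E.
Proof.
move=> cP T10 T20 mW _ _ cW _ hq sub1 sub2 ind pdf1 pdf2.
move=> x y x' y' hx hy hx' hy' xx' yy'.
have hq' p p' : quadrant p -> quadrant p' ->
    (\int[P]_w (W p w * W p' w)%:E = (q `|p.1 - p'.1| `|p.2 - p'.2|)%:E)%E.
  case: p p' => [p1 p2] [p1' p2'] [/= ? ?] [/= ? ?].
  by rewrite -hq// /cov_fun unlock.
have Ws p : quadrant p -> (\int[P]_w (W p w ^+ 2)%:E <= (q 0 0)%:E)%E.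
  move=> qp; under eq_integral do rewrite expr2.
  by rewrite hq'// !subrr normr0.
have mabs (l : R -> {RV P >-> R}) u : measurable_fun setT (fun w => `|l u w|).
  exact: measurableT_comp.
(* The absolute values, immaterial almost surely, keep [U] and [V] in the
   quadrant everywhere, so that only measurable compositions occur. *)
pose U w := (`|l1 x w|, `|l2 y w|); pose V w := (`|l1 x' w|, `|l2 y' w|).
have mU : measurable_fun setT U by exact: measurable_fun_pair.
have mV : measurable_fun setT V by exact: measurable_fun_pair.
have qU w : quadrant (U w) by split => /=.
have qV w : quadrant (V w) by split => /=.
have absE (l : R -> {RV P >-> R}) (a u : R) (A : set R) : 0 <= u <= a ->
    measurable A ->
    sigma_field `[0, a] l ((fun w => `|l u w|) @^-1` A).
  move=> ua mA.
  apply: (@sigma_field_preimage _ _ _ _ _ l u ((fun r : R => `|r|) @^-1` A)).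
    by rewrite /= in_itv.
  by rewrite -[X in measurable X]setTI; exact: (@normr_measurable R setT).
have ind2 A B : sigma_field `[0, T1] l1 A -> sigma_field `[0, T2] l2 B ->
    (P (A `&` B) = P A * P B)%E.
  move=> sA sB; have := ind A B setT sA sB.
  by rewrite setIT probability_setT mule1; apply; exact: sigma_fieldT.
have indUV (A1 A2 A3 A4 : set R) :
  measurable A1 -> measurable A2 -> measurable A3 -> measurable A4 ->
  forall p p' (B : set (R * R)), quadrant p -> quadrant p' -> measurable B ->
  let E := (U @^-1` (A1 `*` A2)) `&` (V @^-1` (A3 `*` A4)) in
  (P (E `&` (fun w => (W p w, W p' w)) @^-1` B) =
  P E * P ((fun w => (W p w, W p' w)) @^-1` B))%E.
  move=> mA1 mA2 mA3 mA4 p p' B qp qp' mB E.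
  (* [U] and [V] each mix both subordinators; regrouping the four constraints gives one event per
     subordinator, to which the independence of the three families applies. *)
  pose E1 := (fun w => `|l1 x w|) @^-1` A1 `&` (fun w => `|l1 x' w|) @^-1` A3.
  pose E2 := (fun w => `|l2 y w|) @^-1` A2 `&` (fun w => `|l2 y' w|) @^-1` A4.
  have sE1 : sigma_field `[0, T1] l1 E1 by apply: sigma_fieldI; exact: absE.
  have sE2 : sigma_field `[0, T2] l2 E2 by apply: sigma_fieldI; exact: absE.
  have -> : E = E1 `&` E2.
    by apply/seteqP; split => w /= [[? ?] [? ?]].
  by rewrite (ind2 E1 E2)// ind//; exact: sigma_field_preimage2.
have frz := freezing_product mW cW mU mV qU qV indUV Ws.
have UV : {ae P, forall w, U w = (l1 x w, l2 y w) /\ V w = (l1 x' w, l2 y' w)}.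
  apply: filterS2
    (filterI (subordinator_ge0 sub1 hx) (subordinator_ge0 sub1 hx'))
    (filterI (subordinator_ge0 sub2 hy) (subordinator_ge0 sub2 hy')).
  by move=> w [lx lx'] [ly ly']; rewrite /U /V !ger0_norm.
have mWU : measurable_fun setT (fun w => W (U w) w).
  exact: (measurable_field_comp mW).
have mWV : measurable_fun setT (fun w => W (V w) w).
  exact: (measurable_field_comp mW).
have mWUV : measurable_fun setT (fun w => (W (U w) w * W (V w) w)%:E).
  by apply/measurable_EFinP; exact: measurable_funM.
have aeWUV : ae_eq P setT (fun w => (W (U w) w * W (V w) w)%:E)
    (fun w => (subordinated W l1 l2 (x, y) w *
               subordinated W l1 l2 (x', y') w)%:E).
  by apply: filterS UV => w [Uw Vw] _; rewrite Uw Vw.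
rewrite /cov_fun unlock.
transitivity (\int[P]_w (W (U w) w * W (V w) w)%:E)%E.
  symmetry; apply: ae_eq_integral => //.
  (* Completeness of [P] enters here: the subordinated product is measurable because it equals a
     measurable function almost everywhere. *)
  exact: (ae_measurable_fun cP aeWUV).
rewrite frz.
under eq_integral do rewrite hq'//=.
(* [QE] below: [Q] extends [q] to the plane by symmetry; in this form it is
   measurable by Fubini's theorem. *)
pose Q (z : R * R) : \bar R :=
  (\int[P]_w (W (`|z.1|, `|z.2|) w * W (0, 0) w)%:E)%E.
have q0 (z : R * R) : quadrant (`|z.1|, `|z.2|) by split => /=.
have q00 : quadrant (0 : R, 0 : R) by split => /=.
have QE z : Q z = (q `|z.1| `|z.2|)%:E.
  by rewrite /Q hq'//= !subr0 !normr_id.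
have mQ : measurable_fun setT Q.
  apply: (@measurable_frozen _ _ _ P _ mW (fun x => x.1 * x.2)%R) => //.
  - by apply: measurable_funM.
  - by apply: measurable_fun_pair; apply: measurableT_comp.
(* The product defining [Q] is at most a sum of two squares, each of mean [q 0 0]. *)
pose C := q 0 0 + q 0 0.
have QC z : (`|Q z| <= C%:E)%E.
  rewrite (le_trans (le_abse_integral _ _ _))//.
    apply/measurable_EFinP; apply: measurable_funM;
      exact: (measurable_field_at mW).
  apply: le_trans (integral_sqrD_le mW Ws (q0 z) q00).
  apply: ge0_le_integral => //.
  - apply: measurableT_comp => //; apply/measurable_EFinP.
    by apply: measurable_funM; exact: (measurable_field_at mW).
  - exact: measurable_int (integrable_sqrD mW Ws (q0 z) q00).
  - by move=> w _; rewrite abse_EFin lee_fin abs_mul_le_sqrD.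
pose f1' w := `| `|l1 x w| - `|l1 x' w| |.
pose f2' w := `| `|l2 y w| - `|l2 y' w| |.
have mD1 : measurable_fun setT f1'.
  by apply: measurableT_comp => //; exact: measurable_funB.
have mD2 : measurable_fun setT f2'.
  by apply: measurableT_comp => //; exact: measurable_funB.
pose D1 : {RV P >-> R} := HB.pack f1' (isMeasurableFun.Build _ _ _ _ _ mD1).
pose D2 : {RV P >-> R} := HB.pack f2' (isMeasurableFun.Build _ _ _ _ _ mD2).
have D10 w : 0 <= D1 w by exact: normr_ge0.
have D20 w : 0 <= D2 w by exact: normr_ge0.
have pdfD a (l : R -> {RV P >-> R}) (f : R -> R -> R) u v (D : {RV P >-> R}) :
    levy_subordinator a l -> (forall r, 0 < r <= a -> is_pdf P (l r) (f r)) ->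
    0 <= u <= a -> 0 <= v <= a -> u != v ->
    (D = (fun w => `| `|l u w| - `|l v w| |) :> (T -> R)) ->
    is_pdf P D (f `|u - v|).
  move=> subl pdfl hu hv uv ->.
  (* As [u] and [v] differ, [|u - v|] lies in []0, a]], where a density is given. *)
  have [|mf f0 Pf] := pdfl `|u - v|.
    by rewrite normr_gt0 subr_eq0 uv ler_norml; lra.
  split => // A mA; rewrite -Pf//.
  exact: (subordinator_increment_law subl hu hv uv mA).
have pdfD1 : is_pdf P D1 (f1 `|x - x'|) by exact: (pdfD T1 l1).
have pdfD2 : is_pdf P D2 (f2 `|y - y'|) by exact: (pdfD T2 l2).
have indD A B : measurable A -> measurable B ->
    (P (D1 @^-1` A `&` D2 @^-1` B) = P (D1 @^-1` A) * P (D2 @^-1` B))%E.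
  move=> mA mB; apply: ind2.
    exact: (sigma_field_increment hx hx').
  exact: (sigma_field_increment hy hy').
transitivity (\int[P]_w Q (D1 w, D2 w))%E.
  by apply: eq_integral => w _; rewrite QE /= /f1' /f2' !normr_id.
rewrite (integral_indep_pair mQ QC indD).
have mQ1 t : measurable_fun setT (fun s => Q (s, t)).
  by apply: (measurableT_comp mQ); exact: pair2_measurable.
(* The density formula is used twice: for [D2] with the bounded function [H], then for [D1] at each
   fixed [t]. *)
pose H t := (\int[P]_w Q (D1 w, t))%E.
have mH : measurable_fun setT H.
  apply: (@measurable_integral_param _ _ _ _ _ P (fun z => Q (D1 z.2, z.1))).
  apply: (measurableT_comp mQ); apply: measurable_fun_pair => //.
  exact: measurableT_comp.
have HC t : (`|H t| <= C%:E)%E.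
  by apply: abse_integral_le_bound => //; exact: (measurableT_comp (mQ1 t)).
rewrite (@integral_nonneg_density _ _ _ P D2 (f2 `|y - y'|) H C)//.
apply: eq_integral => t; rewrite inE /= in_itv/= andbT => t0.
rewrite /H (@integral_nonneg_density _ _ _ P D1 (f1 `|x - x'|)
  (fun s => Q (s, t)) C)//.
(* The factor [f2] is constant in [s]; moving it inside uses integrability of the inner
   integrand. *)
rewrite -integralZr//; last first.
  exact: (@integrable_bounded_mul_density _ _ _ P D1 _ _ (fun s => Q (s, t)) C).
apply: eq_integral => s; rewrite inE /= in_itv/= andbT => s0.
have -> : Q (s, t) = (q s t)%:E by rewrite QE /= !ger0_norm.
by rewrite !EFinM.
Qed.
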